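(* Let $K$ be a field, $S$ a positive normal affine semigroup, $R=K[S]$, and $\sigma: R\to P=K[X_1,\dots,X_s]$ the standard embedding. Let $\mathfrak{m}$ be the maximal ideal of $R$ generated by all non-unit monomials, and $\lambda$ the maximal length of an $R$-sequence consisting of monomials. Let $F_1,\dots,F_s$ be the facets of the cone $C(S)$. Then the following hold: \begin{itemize} \item[(a)] $\operatorname{grade}\mathfrak{m}P$ is the minimal number $u$ of facets $F_{i_1},\dots,F_{i_u}$ of $C(S)$ such that $F_{i_1}\cap\dots\cap F_{i_u}=\{0\}$. \item[(b)] $\lambda$ is the maximal number $\ell$ of subsets $\mathcal{F}_1,\dots,\mathcal{F}_\ell$ of $\mathcal{F}=\{F_1,\dots,F_s\}$ with the following properties: $$ \mathrm{(i)}\quad \mathcal{F}_i\cap\mathcal{F}_j=\emptyset,\qquad \mathrm{(ii)}\quad \bigcap_{F\in\mathcal{F}\setminus \mathcal{F}_i} F\neq\{0\} $$ for all $i,j$ such that $i\neq j$. \end{itemize}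
   Context: Semigroups are commutative, written additively, with $0$. An affine semigroup is a finitely generated subsemigroup of some $\mathbb{Z}^n$; $\operatorname{gp}(S)$ is its group of differences; $S$ is normal if every $x\in\operatorname{gp}(S)$ with $mx\in S$ for some integer $m>0$ lies in $S$, and positive if $0$ is its only invertible element. Identify $\operatorname{gp}(S)=\mathbb{Z}^r$, $r=\operatorname{rank}S$, and let $C(S)\subset\mathbb{R}^r$ be the cone generated by $S$. The support forms $\sigma_1,\dots,\sigma_s$ of $S$ are the (unique up to order) linear forms on $\mathbb{R}^r$ with coprime integer coefficients such that $C(S)=\{x:\sigma_i(x)\ge0,\ i=1,\dots,s\}$ is an irredundant representation; the facets are $F_i=\{x\in C(S):\sigma_i(x)=0\}$. The map $\sigma=(\sigma_1,\dots,\sigma_s)$ sends $S$ into $\mathbb{Z}_+^s$ and induces the standard embedding $K[S]\to K[\mathbb{Z}_+^s]=K[X_1,\dots,X_s]$, through which $R$ is regarded as a subring of $P$. Monomials of $R$ are the elements of $S$. $\operatorname{grade}I$ is the length of a maximal regular sequence contained in the ideal $I$. An empty intersection of facets is understood to be $C(S)$. In (b), property (i) is required for all $i\ne j$ and property (ii) for all $i$. *)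

(* Defs.v *)
From mathcomp Require Import all_boot all_order all_algebra.
From mathcomp Require Import classical_sets reals.
From mathcomp Require Import finmap monalg mpoly.

Set Implicit Arguments.
Unset Strict Implicit.
Unset Printing Implicit Defensive.

Import GRing.Theory Num.Theory.
Local Open Scope ring_scope.

(* Both [monalg] and [mpoly] define this notation; mpoly's is meant here. *)
Notation "{ 'mpoly' T [ n ] }" := (mpoly n T) : type_scope.

Definition is_maximum (Q : nat -> Prop) (n : nat) : Prop :=
  Q n /\ forall k, Q k -> (k <= n)%N.

Definition is_minimum (Q : nat -> Prop) (n : nat) : Prop :=
  Q n /\ forall k, Q k -> (n <= k)%N.

Section Grade.
Variable A : comNzRingType.

Definition ideal_gen (G : set A) : set A :=
  [set a | exists w : seq (A * A),
     (forall c, c \in w -> G c.2) /\ a = \sum_(c <- w) c.1 * c.2]%classic.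

Definition seq_ideal (xs : seq A) : set A :=
  ideal_gen [set x | x \in xs]%classic.

Definition regular_sequence (xs : seq A) : Prop :=
  ~ seq_ideal xs 1 /\
  forall i, (i < size xs)%N -> forall a,
    seq_ideal (take i xs) (xs`_i * a) -> seq_ideal (take i xs) a.

Definition is_grade (I : set A) (g : nat) : Prop :=
  is_maximum (fun k => exists xs : seq A,
    [/\ regular_sequence xs, forall x, x \in xs -> I x & size xs = k]) g.

Definition invertible (a : A) : Prop := exists b, a * b = 1.

End Grade.

(* Semigroups are carried by [conomType] so that {malg K[S]} is the semigroup
   ring K[S]; [mmul] and [mone] are the addition and 0 of S, and <<x>> is the
   monomial of {malg K[S]} given by x. *)
Section Semigroup.
Variable S : conomType.

(* The monomial axiom [unitm] of [conomType] already implies this. *)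
Definition positive_semigroup : Prop :=
  forall x : S, (exists y, mmul x y = mone) -> x = mone.

Definition finitely_generated : Prop :=
  exists gens : seq S, forall x : S, exists w : seq S,
    {subset w <= gens} /\ x = \big[@mmul S/@mone S]_(y <- w) y.

Definition lattice_embedding (n : nat) (iota : S -> 'rV[int]_n) : Prop :=
  [/\ injective iota, iota mone = 0
    & {morph iota : x y / mmul x y >-> x + y}].

Definition affine_semigroup : Prop :=
  finitely_generated /\
  exists (n : nat) (iota : S -> 'rV[int]_n), lattice_embedding iota.

(* [phi] is the inclusion of S in gp(S) for some identification of gp(S)
   with Z^r. *)
Definition gp_identification (r : nat) (phi : S -> 'rV[int]_r) : Prop :=
  lattice_embedding phi /\ forall v, exists x y, v = phi x - phi y.

Definition normal_semigroup (r : nat) (phi : S -> 'rV[int]_r) : Prop :=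
  forall (v : 'rV[int]_r) (m : nat), (0 < m)%N ->
    (exists x, phi x = v *+ m) -> exists x, phi x = v.

End Semigroup.

(* The i-th column of [sigma] holds the coefficients of the i-th form. *)
Definition form_val (A : pzRingType) (r s : nat) (sigma : 'M[int]_(r, s))
    (i : 'I_s) (x : 'rV[A]_r) : A :=
  (x *m map_mx intr sigma) 0 i.

Section Cone.
Variables (RR : realType) (S : conomType) (r s : nat).
Variables (phi : S -> 'rV[int]_r) (sigma : 'M[int]_(r, s)).

Definition cone : set 'rV[RR]_r :=
  [set x | exists w : seq (RR * S),
     (forall c, c \in w -> 0 <= c.1) /\
     x = \sum_(c <- w) c.1 *: map_mx intr (phi c.2)]%classic.

Definition support_forms : Prop :=
  [/\ forall i, \big[gcdn/0%N]_(k < r) `|sigma k i|%N = 1%N,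
      cone = [set x | forall i, 0 <= form_val sigma i x]%classic
    & forall j,
      cone <> [set x | forall i, i != j -> 0 <= form_val sigma i x]%classic].

Definition facet (i : 'I_s) : set 'rV[RR]_r :=
  [set x | cone x /\ form_val sigma i x = 0]%classic.

(* Sets of facets are given by their sets of indices; the facets are pairwise
   distinct. The conjunct [cone x] only matters for the empty intersection. *)
Definition facets_meet (I : {set 'I_s}) : set 'rV[RR]_r :=
  [set x | cone x /\ forall i, i \in I -> facet i x]%classic.

End Cone.

Arguments facets_meet RR [S r s] phi sigma I.

Section StandardEmbedding.
Variables (K : fieldType) (S : conomType) (r s : nat).
Variables (phi : S -> 'rV[int]_r) (sigma : 'M[int]_(r, s)).

(* The values of the support forms on S are nonnegative, so taking absolute
   values only converts them to natural numbers. *)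
Definition std_exponent (x : S) : 'X_{1..s} :=
  [multinom `|form_val sigma i (phi x)|%N | i < s].

Definition std_embedding : {malg K[S]} -> {mpoly K[s]} :=
  monalg.mmap (@mpolyC s K) (fun x => 'X_[std_exponent x]).

Definition monomial_max_ideal : set {malg K[S]} :=
  ideal_gen [set f : {malg K[S]} |
    exists x : S, f = << x >> /\ ~ invertible f]%classic.

Definition extended_max_ideal : set {mpoly K[s]} :=
  ideal_gen [set g | exists f, monomial_max_ideal f /\ g = std_embedding f]%classic.

End StandardEmbedding.

Definition max_monomial_sequence_length (K : fieldType) (S : conomType)
    (l : nat) : Prop :=
  is_maximum (fun k => exists xs : seq S,
    regular_sequence [seq (<< x >> : {malg K[S]}) | x <- xs] /\ size xs = k) l.

(* Main.v *)
(** The monomials of [K[S]] are compared through their exponents in [P]: as [S]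
is normal, [x] divides [y] in [S] iff [sigma x <= sigma y] (a lattice point of
the real cone is a rational, hence after scaling an integral, combination of
generators), and [F_i, i in I] meet in [0] iff [I] meets the support of
[sigma x] for every [x != 0] in [S].

(a) If [I] is such a transversal, [mP] lies in the prime [(X_i, i in I)].  A
regular sequence in this prime followed by the remaining variables is a sequence
whose monomials are linearly independent over [K], so it has at most [s] terms.
Conversely, if every transversal has at least [u] elements, then every set of
more than [s - u] indices contains the support of some [x != 0]; hence for large
[N] the elementary symmetric polynomials of degrees [s, s-1, ..., s-u+1] in the
[X_i ^ N] lie in [mP], and they form a regular sequence in this order.

(b) A sequence of monomials [x != 0] is regular iff the supports of its terms are
pairwise disjoint.  If two supports share the index [t], irredundancy of [F_t]
gives a [z] which is one short of divisibility by the first monomial, at [t]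
only, and becomes divisible after multiplication by the second. *)

Require Import Defs.
From mathcomp Require Import all_boot all_order all_algebra.
From mathcomp Require Import boolp classical_sets reals.
From mathcomp Require Import finmap monalg mpoly.
From mathcomp Require Import zify ring lra.

Set Implicit Arguments.
Unset Strict Implicit.
Unset Printing Implicit Defensive.

Import Order.TTheory GRing.Theory Num.Theory.
Local Open Scope ring_scope.

(** * Sequences regular modulo an ideal *)

Lemma bounded_has_maximum (Q : nat -> Prop) (b : nat) :
  Q 0%N -> (forall k, Q k -> (k <= b)%N) -> exists n, is_maximum Q n.
Proof.
move=> Q0 Qb.
have exQ : exists n, `[< Q n >] by exists 0%N; apply/asboolP.
have bQ n : `[< Q n >] -> (n <= b)%N by move=> /asboolP /Qb.
case: (ex_maxnP exQ bQ) => n /asboolP Qn maxn; exists n; split=> // k Qk.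
by apply: maxn; apply/asboolP.
Qed.

Lemma inhabited_has_minimum (Q : nat -> Prop) (b : nat) :
  Q b -> exists n, is_minimum Q n.
Proof.
move=> Qb; have exQ : exists n, `[< Q n >] by exists b; apply/asboolP.
case: (ex_minnP exQ) => n /asboolP Qn minn; exists n; split=> // k Qk.
by apply: minn; apply/asboolP.
Qed.

Section Ideals.
Variable A : comNzRingType.
Implicit Types (J : set A) (a b c x y : A) (xs ys : seq A).

Definition is_ideal J :=
  [/\ J 0, forall x y, J x -> J y -> J (x + y) & forall a x, J x -> J (a * x)].

Definition adjoin J b : set A := [set x | exists c, J (x - c * b)]%classic.

Definition colon J b : set A := [set a | J (b * a)]%classic.

(** Properness of the final ideal is left out, so that every sequence is regular modulo the unit
    ideal, where a later induction ends. *)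
Fixpoint regular_mod J xs : Prop :=
  if xs is x :: xs' then
    (forall a, J (x * a) -> J a) /\ regular_mod (adjoin J x) xs'
  else True.

Lemma ideal0 J : is_ideal J -> J 0. Proof. by case. Qed.

Lemma idealD J x y : is_ideal J -> J x -> J y -> J (x + y).
Proof. by case=> _ D _; apply: D. Qed.

Lemma idealM J a x : is_ideal J -> J x -> J (a * x).
Proof. by case=> _ _; apply. Qed.

Lemma idealN J x : is_ideal J -> J x -> J (- x).
Proof. by move=> idJ Jx; rewrite -mulN1r; apply: idealM. Qed.

Lemma idealB J x y : is_ideal J -> J x -> J y -> J (x - y).
Proof. by move=> idJ Jx Jy; apply: idealD => //; apply: idealN. Qed.

Lemma ideal_sum J (T : Type) (r : seq T) (P : pred T) (F : T -> A) :
  is_ideal J -> (forall i, P i -> J (F i)) -> J (\sum_(i <- r | P i) F i).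
Proof.
move=> idJ JF; apply: (big_ind J) => //; first exact: ideal0.
by move=> x y; apply: idealD.
Qed.

Lemma adjoin_ideal J b : is_ideal J -> is_ideal (adjoin J b).
Proof.
move=> idJ; split.
- by exists 0; rewrite mul0r subr0; apply: ideal0.
- move=> x y [c Jx] [d Jy]; exists (c + d).
  by rewrite mulrDl opprD addrACA; apply: idealD.
- move=> a x [c Jx]; exists (a * c).
  by rewrite -mulrA -mulrBr; apply: idealM.
Qed.

Lemma sub_adjoin J b x : J x -> adjoin J b x.
Proof. by exists 0; rewrite mul0r subr0. Qed.

Lemma adjoin_gen J b : is_ideal J -> adjoin J b b.
Proof. by move=> idJ; exists 1; rewrite mul1r subrr; apply: ideal0. Qed.

Lemma adjoin_min J J' b x :
  is_ideal J' -> (forall y, J y -> J' y) -> J' b -> adjoin J b x -> J' x.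
Proof.
move=> idJ' JJ' J'b [c /JJ' J'x]; rewrite -(subrK (c * b) x).
by apply: idealD => //; apply: idealM.
Qed.

Lemma adjoinAC J b x :
  is_ideal J -> adjoin (adjoin J b) x = adjoin (adjoin J x) b.
Proof.
move=> idJ; rewrite predeqE => y; split=> -[c [d Jy]]; exists d; exists c.
  by rewrite addrAC.
by rewrite addrAC.
Qed.

(** If $by = cx$ modulo $J$, then $xc \in J + (b)$, so $c \in J + (b)$ by regularity of $x$; writing
    $c = db$ modulo $J$ gives $b(y - dx) \in J$. *)
Lemma colon_adjoin J b x : is_ideal J ->
    (forall a, adjoin J b (x * a) -> adjoin J b a) ->
  colon (adjoin J x) b = adjoin (colon J b) x.
Proof.
move=> idJ regx; rewrite predeqE => y; split=> -[c Jy].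
  have [d Jd] : adjoin J b c.
    apply: regx; exists y.
    by rewrite -opprB -[y * b]mulrC [x * c]mulrC; apply: idealN.
  exists d; rewrite /colon /=.
  have -> : b * (y - d * x) = b * y - c * x + x * (c - d * b) by ring.
  by apply: idealD => //; apply: idealM.
exists (b * c).
by have -> : b * y - b * c * x = b * (y - c * x) by ring.
Qed.

(* 0 -> A/(J:b) -> A/J -> A/(J+b) -> 0 is exact, and a sequence which is
   regular on both ends of a short exact sequence is regular in the middle. *)
Lemma regular_mod_extension J b xs : is_ideal J ->
  regular_mod (colon J b) xs -> regular_mod (adjoin J b) xs ->
  regular_mod J xs.
Proof.
elim: xs J => //= x xs IH J idJ [reg1 Reg1] [reg2 Reg2]; split.
  move=> a Jxa; have [c Jc] : adjoin J b a by apply: reg2; apply: sub_adjoin.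
  have Jbc : J (b * c).
    apply: reg1; rewrite /colon /=.
    have -> : b * (x * c) = x * a - x * (a - c * b) by ring.
    by apply: idealB => //; apply: idealM.
  by rewrite -(subrK (c * b) a); apply: idealD => //; rewrite mulrC.
apply: IH; first exact: adjoin_ideal.
  by rewrite colon_adjoin.
by rewrite adjoinAC.
Qed.

Lemma regular_mod_full J xs : (forall x, J x) -> regular_mod J xs.
Proof.
elim: xs J => //= x xs IH J Jall; split=> //.
by apply: IH => y; apply: sub_adjoin.
Qed.

Lemma regular_mod_take J xs k : regular_mod J xs -> regular_mod J (take k xs).
Proof.
elim: xs J k => [|x xs IH] J [|k] //= [regx Regxs].
by split=> //; apply: IH.
Qed.

Lemma ideal_gen_ideal (G : set A) : is_ideal (ideal_gen G).
Proof.
split.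
- by exists [::]; rewrite big_nil.
- move=> _ _ [w1 [G1 ->]] [w2 [G2 ->]]; exists (w1 ++ w2).
  split; last by rewrite big_cat.
  by move=> c; rewrite mem_cat => /orP[/G1|/G2].
- move=> a _ [w [Gw ->]]; exists [seq (a * p.1, p.2) | p <- w]; split.
    by move=> c /mapP[d /Gw ? ->].
  by rewrite big_map mulr_sumr; apply: eq_bigr => c _; rewrite mulrA.
Qed.

Lemma sub_ideal_gen (G : set A) x : G x -> ideal_gen G x.
Proof.
move=> Gx; exists [:: (1, x)]; rewrite big_seq1 mul1r; split=> // c.
by rewrite inE => /eqP->.
Qed.

Lemma ideal_gen_min (G J : set A) x :
  is_ideal J -> (forall y, G y -> J y) -> ideal_gen G x -> J x.
Proof.
move=> idJ GJ [w [Gw ->]]; rewrite big_seq; apply: ideal_sum => // c cw.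
by apply: idealM => //; apply: GJ; apply: Gw.
Qed.

Lemma seq_ideal_nil : seq_ideal (Nil A) = [set 0]%classic.
Proof.
rewrite predeqE => x; split=> [|->]; last by apply: ideal0; apply: ideal_gen_ideal.
apply: ideal_gen_min => //; split=> //.
  by move=> y z -> ->; rewrite addr0.
by move=> a y ->; rewrite mulr0.
Qed.

Lemma seq_ideal_rcons xs x : seq_ideal (rcons xs x) = adjoin (seq_ideal xs) x.
Proof.
have idxs := ideal_gen_ideal [set y | y \in xs]%classic.
rewrite predeqE => z; split.
  apply: ideal_gen_min; first exact: adjoin_ideal.
  move=> y /=; rewrite mem_rcons inE => /orP[/eqP->|yxs].
    exact: adjoin_gen.
  by apply: sub_adjoin; apply: sub_ideal_gen.
apply: adjoin_min; first exact: ideal_gen_ideal.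
  move=> y; apply: ideal_gen_min; first exact: ideal_gen_ideal.
  by move=> t /= txs; apply: sub_ideal_gen; rewrite /= mem_rcons inE txs orbT.
by apply: sub_ideal_gen; rewrite /= mem_rcons mem_head.
Qed.

(** The prefix [ys] collects the elements already adjoined, as the induction on [xs] requires. *)
Lemma regular_mod_seq_ideal ys xs i a :
  regular_mod (seq_ideal ys) xs -> (i < size xs)%N ->
  seq_ideal (ys ++ take i xs) (xs`_i * a) -> seq_ideal (ys ++ take i xs) a.
Proof.
elim: xs ys i => [|x xs IH] ys [|i] //= [regx Regxs].
  by move=> _; rewrite cats0; apply: regx.
by rewrite ltnS -cat_rcons; apply: IH; rewrite seq_ideal_rcons.
Qed.

Lemma regular_sequence_of_mod0 xs :
  regular_mod [set 0]%classic xs -> ~ seq_ideal xs 1 -> regular_sequence xs.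
Proof.
rewrite -seq_ideal_nil => Reg prop; split=> // i ltis a.
by have := @regular_mod_seq_ideal [::] xs i a Reg ltis.
Qed.

End Ideals.

(** * Independence of monomials in polynomials *)

Section MonomialIndependence.
Variables (K : fieldType) (s : nat).
Local Notation P := {mpoly K[s]}.
Implicit Types (J : set P) (f g : P) (fs : seq P) (a : seq nat).

Fixpoint exponents D m : seq (seq nat) :=
  if m is m'.+1 then [seq e :: a | e <- iota 0 D, a <- exponents D m']
  else [:: [::]].

Fixpoint seq_monomial fs a : P :=
  match fs, a with
  | f :: fs', e :: a' => f ^+ e * seq_monomial fs' a'
  | _, _ => 1
  end.

Definition lin_comb D fs (b : seq nat -> K) : P :=
  \sum_(a <- exponents D (size fs)) b a *: seq_monomial fs a.

(** This is algebraic independence over $K$ of the residue classes of [fs] in $P/J$. *)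
Definition independent_mod J fs :=
  forall D b, J (lin_comb D fs b) ->
    forall a, a \in exponents D (size fs) -> b a = 0.

Lemma size_exponents D m : size (exponents D m) = (D ^ m)%N.
Proof. by elim: m => //= m IH; rewrite size_allpairs size_iota IH expnS. Qed.

Lemma uniq_exponents D m : uniq (exponents D m).
Proof.
elim: m => //= m IH; apply: allpairs_uniq => //; first exact: iota_uniq.
by move=> [e a] [e' a'] _ _ /= [-> ->].
Qed.

Lemma lin_comb_cons D f fs b :
  lin_comb D (f :: fs) b =
  \sum_(e <- iota 0 D) f ^+ e * lin_comb D fs (fun a => b (e :: a)).
Proof.
rewrite /lin_comb /= big_allpairs_dep; apply: eq_bigr => e _.
by rewrite mulr_sumr; apply: eq_bigr => a _; rewrite scalerAr.
Qed.

Lemma independent_mod_nil J : is_ideal J -> ~ J 1 -> independent_mod J [::].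
Proof.
move=> idJ J1 D b; rewrite /lin_comb /= big_seq1 => Jb a.
rewrite inE => /eqP->; apply/eqP/negPn/negP => b0; apply: J1.
have -> : 1 = (b [::])^-1%:MP * (b [::] *: 1) :> P.
  by rewrite mul_mpolyC scalerA mulVf // scale1r.
exact: idealM.
Qed.

Lemma independent_mod_sub J J' fs :
  (forall x, J x -> J' x) -> independent_mod J' fs -> independent_mod J fs.
Proof. by move=> JJ' indep D b /JJ'; apply: indep. Qed.

(** In a relation sorted by powers of $f$, the lowest power can be cancelled; what it multiplies
    then lies in $J + (f)$, so its coefficients vanish and the next power becomes the lowest. *)
Lemma independent_mod_cons J f fs : is_ideal J ->
  (forall g, J (f * g) -> J g) -> independent_mod (adjoin J f) fs ->
  independent_mod J (f :: fs).
Proof.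
move=> idJ reg indep D b; rewrite lin_comb_cons => Jb.
set g := fun e => lin_comb D fs (fun a => b (e :: a)) in Jb.
have regX n h : J (f ^+ n * h) -> J h.
  elim: n => [|n IH]; first by rewrite expr0 mul1r.
  by rewrite exprS -mulrA => /reg /IH.
have b0 n e a : (e < n)%N -> (e < D)%N -> a \in exponents D (size fs) ->
    b (e :: a) = 0.
  elim: n e a => // n IH e a; rewrite ltnS leq_eqVlt => /orP[/eqP->|]; last first.
    exact: IH.
  move=> ltnD; apply: (indep D (fun a => b (n :: a))); rewrite -/(g n).
  (* The cofactor of $f$ is minus the higher powers divided by $f^{n+1}$; the lower powers vanish by
     induction. *)
  exists (- \sum_(e <- iota n.+1 (D - n.+1)) f ^+ (e - n.+1) * g e).
  apply: (regX n); rewrite mulNr opprK.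
  suff <- : \sum_(e <- iota 0 D) f ^+ e * g e =
    f ^+ n * (g n +
      (\sum_(e <- iota n.+1 (D - n.+1)) f ^+ (e - n.+1) * g e) * f) by [].
  have -> : D = (n + (1 + (D - n.+1)))%N by lia.
  rewrite !iotaD !big_cat /= big_seq1 big_seq big1 ?add0r => [|e' e'n].
    rewrite mulrDr addn1 (_ : _ - _ = D - n.+1)%N; last lia.
    congr (_ + _); rewrite mulr_suml mulr_sumr big_seq [RHS]big_seq.
    apply: eq_bigr => e'; rewrite mem_iota => /andP[le1 _].
    rewrite -{1}(subnKC le1) exprD exprS; ring.
  rewrite /g /lin_comb big_seq big1 ?mulr0 // => a' a'P.
  by move: e'n; rewrite mem_iota => lt; rewrite (IH e') ?scale0r //; lia.
move=> a /allpairsP[[e a'] /= [eD a'P ->]]; apply: (b0 D) => //.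
all: by rewrite mem_iota in eD.
Qed.

Lemma seq_monomial_mdeg fs D a m :
  a \in exponents D (size fs) -> m \in msupp (seq_monomial fs a) ->
  (mdeg m <= D * \sum_(f <- fs) msize f)%N.
Proof.
have degM p q dp dq : (forall m, m \in msupp p -> (mdeg m <= dp)%N) ->
    (forall m, m \in msupp q -> (mdeg m <= dq)%N) ->
    forall m, m \in msupp (p * q) -> (mdeg m <= dp + dq)%N.
  move=> Hp Hq k /msuppM_le /allpairsP[[k1 k2] /= [/Hp ? /Hq ? ->]].
  by rewrite mdegD leq_add.
have deg1 k : k \in msupp (1 : P) -> (mdeg k <= 0)%N.
  by rewrite msupp1 inE => /eqP->; rewrite mdeg0.
elim: fs a m => [|f fs IH] a m /=.
  by move=> _ /deg1 /leq_trans->.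
move=> /allpairsP[[e a'] /= [eD a'P ->]]; rewrite big_cons mulnDr.
apply: (degM) => [k|k]; last exact: IH.
rewrite mem_iota /= in eD; move=> kf.
apply: (@leq_trans (e * msize f)); last by rewrite leq_mul2r ltnW // orbT.
elim: {eD} e k kf => [|e IHe] k; first by rewrite expr0 mul0n => /deg1.
rewrite exprS mulSn; apply: (degM) => // k' /msize_mdeg_lt; exact: ltnW.
Qed.

(* The exponents below [D] give [D ^ size fs] linearly independent monomials in
   [fs], inside the space of polynomials of degree at most [D * c], which has
   dimension at most [(D * c + 1) ^ s]. *)
Lemma independent_mod_size J fs :
  is_ideal J -> independent_mod J fs -> (size fs <= s)%N.
Proof.
move=> idJ indep; rewrite leqNgt; apply/negP => lts.
set c := (\sum_(f <- fs) msize f)%N.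
(* With this $D$, $(Dc+1)^s \le D^s (c+1)^s < D^{s+1}$, which contradicts the rank bound at the
   end. *)
pose D := ((c.+1 ^ s).+1)%N.
pose E := exponents D (size fs).
pose mnm (u : {ffun 'I_s -> 'I_(D * c).+1}) : 'X_{1..s} := [multinom val (u i) | i < s].
(* Rows are coefficient vectors of the monomials in [fs]; a relation between them is a combination
   equal to $0$, hence in $J$. *)
pose M := \matrix_(i < size E, j < #|{ffun 'I_s -> 'I_(D * c).+1}|)
  (seq_monomial fs (nth [::] E i))@_(mnm (enum_val j)) : 'M[K]__.
have freeM : row_free M.
  rewrite -kermx_eq0; apply/rowV0P => v /sub_kermxP vM0.
  pose b a := if insub (index a E) is Some i then v 0 i else 0.
  have bE (i : 'I_(size E)) : b (nth [::] E i) = v 0 i.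
    by rewrite /b index_uniq ?uniq_exponents ?ltn_ord // valK.
  have comb0 : lin_comb D fs b = 0.
    have combE : lin_comb D fs b =
        \sum_(i < size E) v 0 i *: seq_monomial fs (nth [::] E i).
      rewrite /lin_comb -/E (big_nth [::]) big_mkord.
      by apply: eq_bigr => i _; rewrite bE.
    apply/mpolyP => m; rewrite mcoeff0 combE linear_sum /=.
    have [small|large] := boolP [forall i, (m i < (D * c).+1)%N]; last first.
      rewrite big1 // => i _; rewrite mcoeffZ memN_msupp_eq0 ?mulr0 //.
      apply/negP => /seq_monomial_mdeg -/(_ D); rewrite mem_nth // => /(_ isT).
      rewrite -/c => le_deg; case/negP: large; apply/forallP => j.
      by rewrite ltnS (leq_trans _ le_deg) // mdegE (bigD1 j) //= leq_addr.
    pose u := [ffun i => Ordinal (forallP small i)].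
    have -> : m = mnm u by apply/mnmP => i; rewrite mnmE ffunE.
    have := congr1 (fun w : 'rV_ _ => w 0 (enum_rank u)) vM0.
    rewrite !mxE => vMu; rewrite -[RHS]vMu; apply: eq_bigr => i _.
    by rewrite mcoeffZ mxE enum_rankK.
  apply/rowP => i; rewrite mxE -bE; apply: (indep D).
    by rewrite comb0; apply: ideal0.
  by rewrite mem_nth.
have := rank_leq_col M; rewrite (eqP freeM) size_exponents card_ffun !card_ord.
apply/negP; rewrite -ltnNge.
apply: (@leq_trans (D ^ s.+1)); last by rewrite leq_pexp2l.
apply: (@leq_ltn_trans ((D * c.+1) ^ s)%N).
  by case: (s) => // s'; rewrite leq_exp2r // mulnS; lia.
by rewrite expnMn expnS mulnC ltn_mul2r expn_gt0 /= /D ltnSn.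
Qed.

End MonomialIndependence.

(** * Ideals generated by powers of variables *)

Section VariableIdeals.
Variables (K : fieldType) (s : nat).
Local Notation P := {mpoly K[s]}.
Implicit Types (f g : P) (m : 'X_{1..s}) (W T : {set 'I_s}) (t : 'I_s).

(* The ideal generated by the N-th powers of the variables in W. *)
Definition pow_ideal N W : set P :=
  [set f : P | forall m, (forall i, i \in W -> (m i < N)%N) -> f@_m = 0]%classic.

Definition box N T : 'X_{1..s} := [multinom (N * (i \in T))%N | i < s].

Definition elem_sym N k : P := \sum_(T : {set 'I_s} | #|T| == k) 'X_[box N T].

Fixpoint elem_syms N k : seq P :=
  if k is k'.+1 then elem_sym N k :: elem_syms N k' else [::].

Lemma pow_ideal_ideal N W : is_ideal (pow_ideal N W).
Proof.
split=> [m _|f g Jf Jg m small|a f Jf m small]; first by rewrite mcoeff0.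
  by rewrite mcoeffD Jf // Jg // addr0.
rewrite mcoeffM big1 // => k /eqP mE; rewrite Jf ?mulr0 // => i iW.
apply: leq_ltn_trans (small i iW).
by have /= -> := congr1 (fun m' : 'X_{1..s} => m' i) mE; rewrite mnmDE leq_addl.
Qed.

Lemma pow_idealX N W m t :
  t \in W -> (N <= m t)%N -> pow_ideal N W 'X_[m].
Proof.
move=> tW le_m k small; rewrite mcoeffX.
by case: eqP (small t tW) => // <-; rewrite ltnNge le_m.
Qed.

Lemma pow_ideal0 N : pow_ideal N finset.set0 = [set 0]%classic.
Proof.
rewrite predeqE => f; split=> [Jf|-> m _]; last by rewrite mcoeff0.
by apply/mpolyP => m; rewrite mcoeff0 Jf // => i; rewrite inE.
Qed.

Lemma pow_ideal_proper N W : (0 < N)%N -> ~ pow_ideal N W 1.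
Proof.
move=> N0 /(_ 0%MM); rewrite mcoeff1 eqxx => H.
suff /eqP : 1 = 0 :> K by rewrite oner_eq0.
by apply: H => i _; rewrite mnm0E.
Qed.

(** Multiplication by $X^m$ shifts exponents by $m$, which leaves their entries at [W] unchanged. *)
Lemma pow_ideal_regular N W m f : (forall i, i \in W -> m i = 0%N) ->
  pow_ideal N W ('X_[m] * f) -> pow_ideal N W f.
Proof.
move=> m0 Jmf k small; rewrite -(mcoeffMX f m) mulrC Jmf // => i iW.
by rewrite mnmDE m0 // add0n small.
Qed.

Lemma box_out N T W i : W \subset ~: T -> i \in W -> box N T i = 0%N.
Proof.
by move=> /fintype.subsetP WT /WT; rewrite mnmE inE => /negbTE->; rewrite muln0.
Qed.

Lemma boxU1 N T t : t \notin T ->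
  'X_[box N (t |: T)] = 'X_[box N [set t]] * 'X_[box N T] :> P.
Proof.
move=> tT; rewrite -mpolyXD; congr mpolyX; apply/mnmP => i.
rewrite mnmDE !mnmE !inE; case: eqP => [->|] /=.
  by rewrite (negbTE tT) muln0 addn0.
by rewrite muln0.
Qed.

Lemma adjoin_pow_ideal N W t : t \notin W ->
  adjoin (pow_ideal N W) 'X_[box N [set t]] = pow_ideal N (t |: W).
Proof.
move=> tW; rewrite predeqE => f; split.
  apply: adjoin_min; first exact: pow_ideal_ideal.
    move=> g Jg m small; apply: Jg => i iW.
    by apply: small; rewrite inE iW orbT.
  apply: (@pow_idealX _ _ _ t); first by rewrite setU11.
  by rewrite mnmE set11 muln1.
(* The cofactor is the quotient by $X_t^N$ of the terms of $f$ divisible by it; the other terms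
   already lie in [pow_ideal N W]. *)
move=> Jf; exists (\sum_(m <- msupp f | (N <= m t)%N)
  f@_m *: 'X_[(m - box N [set t])%MM]).
rewrite {1}(mpolyE f) (bigID (fun m => N <= m t)%N) /= mulr_suml.
rewrite [X in X + _ - _](_ : _ = \sum_(m <- msupp f | (N <= m t)%N)
  f@_m *: 'X_[(m - box N [set t])%MM] * 'X_[box N [set t]]); last first.
  apply: eq_bigr => m le_m; rewrite -scalerAl -mpolyXD submK //.
  apply/mnm_lepP => i; rewrite mnmE inE; case: eqP => [->|_].
    by rewrite muln1.
  by rewrite muln0.
rewrite addrAC subrr add0r; apply: ideal_sum; first exact: pow_ideal_ideal.
move=> m; rewrite -ltnNge => lt_m k small; rewrite mcoeffZ mcoeffX.
case: eqP => [mk|_]; last by rewrite mulr0.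
rewrite mulr1 Jf // => i; rewrite inE => /orP[|iW]; last by rewrite mk small.
by rewrite inE => /eqP->.
Qed.

Lemma adjoin_congr (A : comNzRingType) (J : set A) x y :
  is_ideal J -> J (x - y) -> adjoin J x = adjoin J y.
Proof.
move=> idJ Jxy; rewrite predeqE => z; split=> -[c Jz]; exists c.
  have -> : z - c * y = z - c * x + c * (x - y) by ring.
  by apply: idealD => //; apply: idealM.
have -> : z - c * x = z - c * y - c * (x - y) by ring.
by apply: idealB => //; apply: idealM.
Qed.

(** A set of size $n$ other than the complement of [W] meets [W], so its term is divisible by some
    $X_i^N$ with $i$ in [W]. *)
Lemma elem_sym_congr N W n : #|~: W| = n ->
  pow_ideal N W (elem_sym N n - 'X_[box N (~: W)]).
Proof.
move=> cardW; rewrite /elem_sym (bigD1 (~: W)) ?cardW //= addrAC subrr add0r.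
apply: ideal_sum; first exact: pow_ideal_ideal.
move=> T /andP[/eqP cardT neqT].
have [i iT iW] : exists2 i, i \in T & i \in W.
  apply/exists_inP; apply: contraNT neqT => /exists_inPn disj.
  rewrite eqEcard cardW cardT leqnn andbT; apply/fintype.subsetP => i iT.
  by rewrite inE; apply: disj.
by apply: (@pow_idealX _ _ _ i iW); rewrite mnmE iT muln1.
Qed.

(* Modulo the N-th powers of all but n variables, the n-th elementary symmetric
   polynomial is the product of the N-th powers of the remaining variables; it
   is split off one factor at a time, and each factor lowers n. *)
Lemma elem_syms_regular N W n : #|~: W| = n ->
  regular_mod (pow_ideal N W) (elem_syms N n).
Proof.
elim: n W => //= n IH W cardW; split.
  move=> f Jf; apply: (@pow_ideal_regular N W (box N (~: W))).
    by move=> i; apply: box_out; rewrite finset.setCK.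
  have -> : 'X_[box N (~: W)] * f =
      elem_sym N n.+1 * f - f * (elem_sym N n.+1 - 'X_[box N (~: W)]) by ring.
  apply: (idealB (pow_ideal_ideal N W)) => //.
  by apply: (idealM _ (pow_ideal_ideal N W)); exact: elem_sym_congr.
rewrite (adjoin_congr (pow_ideal_ideal N W) (elem_sym_congr (N := N) cardW)).
suff split_off T : T \subset ~: W ->
  regular_mod (adjoin (pow_ideal N W) 'X_[box N T]) (elem_syms N n) by exact: split_off.
have idJ := pow_ideal_ideal N W.
have [k cardT] : exists k, k = #|T| by exists #|T|.
elim: k T cardT => [|k IHk] T cardT subT.
  (* For empty $T$ the monomial is $1$ and the ideal is all of $P$. *)
  apply: regular_mod_full => f; exists f.
  rewrite (_ : box N T = 0%MM) ?mpolyX0 ?mulr1 ?subrr; first exact: ideal0.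
  move/esym/eqP: cardT; rewrite cards_eq0 => /eqP->.
  by apply/mnmP => i; rewrite mnmE inE muln0 mnm0E.
have [t tT] : exists t, t \in T by apply/card_gt0P; rewrite -cardT.
have tW : t \notin W by move/fintype.subsetP: subT => /(_ t tT); rewrite inE.
have TE : 'X_[box N T] = 'X_[box N [set t]] * 'X_[box N (T :\ t)] :> P.
  by rewrite -boxU1 ?finset.setD1K // !inE eqxx.
apply: (@regular_mod_extension _ _ 'X_[box N [set t]]).
- exact: adjoin_ideal.
(* As $t \notin W$, the power $X_t^N$ is regular modulo [pow_ideal N W] and cancels from the
   monomial of $T$. *)
- have -> : colon (adjoin (pow_ideal N W) 'X_[box N T]) 'X_[box N [set t]] =
      adjoin (pow_ideal N W) 'X_[box N (T :\ t)].
    rewrite predeqE => f; split=> -[c Jc]; exists c.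
      apply: (@pow_ideal_regular _ _ (box N [set t])).
        by move=> i; apply: box_out; rewrite finset.subsetC finset.sub1set inE.
      rewrite (_ : _ * _ = 'X_[box N [set t]] * f - c * 'X_[box N T]) // TE; ring.
    rewrite (_ : _ - _ = 'X_[box N [set t]] * (f - c * 'X_[box N (T :\ t)])).
      exact: (idealM _ idJ).
    rewrite TE; ring.
  apply: IHk; last by apply: (fintype.subset_trans _ subT); apply: finset.subsetDl.
  by move: cardT; rewrite (cardsD1 t) tT => -[].
(* Once $X_t^N$ is adjoined, it absorbs the monomial of $T$, and the outer induction applies to
   [t |: W]. *)
- rewrite adjoinAC // adjoin_pow_ideal //.
  have J't f : pow_ideal N (t |: W) f ->
      adjoin (pow_ideal N (t |: W)) 'X_[box N T] f by exact: sub_adjoin.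
  have -> : adjoin (pow_ideal N (t |: W)) 'X_[box N T] = pow_ideal N (t |: W).
    rewrite predeqE => f; split=> [Jf|/J't //].
    apply: (adjoin_min (pow_ideal_ideal N (t |: W)) _ _ Jf) => //.
    by apply: (@pow_idealX _ _ _ t); rewrite ?setU11 // mnmE tT muln1.
  apply: IH; rewrite finset.setCU finset.setIC -finset.setDE.
  by move: cardW; rewrite (cardsD1 t) inE tW => -[].
Qed.

(** The lower bound on $j$ later puts every term of these polynomials into $\mathfrak{m}P$. *)
Lemma elem_syms_mem N n k f : f \in take k (elem_syms N n) ->
  exists j, [/\ (0 < j)%N, (n - k < j)%N & f = elem_sym N j].
Proof.
elim: n k => [|n IH] [|k] //=; rewrite inE => /orP[/eqP->|/IH[j [j0 lt ->]]].
  by exists n.+1; split=> //; rewrite subSS ltnS leq_subr.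
by exists j; split=> //; rewrite subSS.
Qed.

Lemma size_elem_syms N n : size (elem_syms N n) = n.
Proof. by elim: n => //= n ->. Qed.

Lemma elem_syms_regular_sequence N u : (0 < N)%N ->
  regular_sequence (take u (elem_syms N s)).
Proof.
move=> N0; apply: regular_sequence_of_mod0.
  apply: regular_mod_take; rewrite -(pow_ideal0 N); apply: elem_syms_regular.
  by rewrite finset.setC0 cardsT card_ord.
(* Properness holds because the whole list lies in the ideal of the $N$-th powers of all
   variables. *)
move=> J1; apply: (@pow_ideal_proper N finset.setT N0).
move: J1; apply: ideal_gen_min; first exact: pow_ideal_ideal.
move=> f /= /elem_syms_mem[j [j0 _ ->]]; apply: ideal_sum.
  exact: pow_ideal_ideal.
move=> T /eqP cardT; have [t tT] : exists t, t \in T.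
  by apply/card_gt0P; rewrite cardT.
by apply: (@pow_idealX _ _ _ t); rewrite ?inE // mnmE tT muln1.
Qed.

(** The variables outside [W] are independent modulo the prime generated by those in [W], hence
    modulo the smaller ideal of [fs]. Regularity allows prepending the elements of [fs] from last to
    first, and the joint length is at most $s$. *)
Lemma regular_in_variables_size W (fs : seq P) :
  regular_sequence fs -> (forall f, f \in fs -> pow_ideal 1 W f) ->
  (size fs <= #|W|)%N.
Proof.
move=> [proper reg] Jfs.
have indepX (ts : seq 'I_s) (V : {set 'I_s}) : uniq ts -> (forall t, t \in ts -> t \notin V) ->
    independent_mod (pow_ideal 1 V) [seq 'X_[box 1 [set t]] | t <- ts].
  elim: ts V => /= [V _ _|t ts IH V /andP[tts uts] tsV].
    by apply: independent_mod_nil; [apply: pow_ideal_ideal|apply: pow_ideal_proper].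
  have tV : t \notin V by apply: tsV; rewrite mem_head.
  apply: independent_mod_cons; first exact: pow_ideal_ideal.
    move=> f; apply: pow_ideal_regular => i; apply: box_out.
    by rewrite finset.subsetC finset.sub1set inE.
  rewrite adjoin_pow_ideal //; apply: IH => // t' t'ts.
  rewrite !inE negb_or tsV ?inE ?t'ts ?orbT // andbT.
  by apply: contraNneq tts => <-.
have indep xs ys : xs ++ ys = fs ->
    independent_mod (seq_ideal xs)
      (ys ++ [seq 'X_[box 1 [set t]] | t <- enum (~: W)]).
  elim: ys xs => [|y ys IH] xs /= fsE.
    apply: (@independent_mod_sub _ _ _ (pow_ideal 1 W)).
      move=> f; apply: ideal_gen_min; first exact: pow_ideal_ideal.
      by move=> x /= xxs; apply: Jfs; rewrite -fsE mem_cat xxs.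
    by apply: indepX => [|t]; rewrite ?enum_uniq // mem_enum inE.
  apply: independent_mod_cons; first exact: ideal_gen_ideal.
    move=> f; have := reg (size xs) _ f; rewrite -fsE take_size_cat //.
    by rewrite nth_cat ltnn subnn /= size_cat /= addnS ltnS leq_addr; apply.
  by rewrite -seq_ideal_rcons; apply: IH; rewrite cat_rcons.
have := independent_mod_size (ideal_gen_ideal _) (indep [::] fs erefl).
rewrite size_cat size_map -cardE; have := cardsC W; rewrite card_ord => sE.
by rewrite -[X in (_ <= X)%N]sE leq_add2r.
Qed.

End VariableIdeals.

(** * Lattice points of the cone *)

Lemma positive_lower_bound (RR : realFieldType) k (e : 'I_k -> RR) :
  (forall i, 0 < e i) -> exists2 eps, 0 < eps & forall i, eps <= e i.
Proof.
(* The inverse of $E$ replaces a minimum and also covers $k = 0$. *)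
move=> e0; pose E := 1 + \sum_i (e i)^-1.
have sum0 (Q : pred 'I_k) : 0 <= \sum_(i | Q i) (e i)^-1.
  by apply: sumr_ge0 => i _; rewrite invr_ge0 ltW.
have E0 : 0 < E by rewrite ltr_pwDl // sum0.
exists E^-1; first by rewrite invr_gt0.
move=> i; rewrite invf_ple ?posrE // /E (bigD1 i) //=.
by have := sum0 (fun j => j != i); lra.
Qed.

(* Moving the real solution c inside c + ker A, whose rational points are
   dense. *)
Lemma rational_positive_solution (RR : realType) k r (A : 'M[rat]_(k, r))
    (v : 'rV[rat]_r) (c : 'rV[RR]_k) :
  (forall i, 0 < c 0 i) -> c *m map_mx ratr A = map_mx ratr v ->
  exists2 q : 'rV[rat]_k, forall i, 0 < q 0 i & q *m A = v.
Proof.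
move=> c0 cA.
(* Inclusion of row spaces is invariant under field extension, so a real solution yields a rational
   one, without sign control. *)
have vA : (v <= A)%MS by rewrite -(map_submx (ratr : rat -> RR)) -cA submxMl.
pose q0 := v *m pinvmx A; have q0A : q0 *m A = v by rewrite mulmxKpV.
pose N := kermx A.
have : (c - map_mx ratr q0 <= map_mx (ratr : rat -> RR) N)%MS.
  rewrite map_kermx; apply/sub_kermxP.
  by rewrite mulmxBl cA -map_mxM q0A subrr.
move=> /submxP[t tE].
(* The summand $1$ makes the error $\varepsilon \sum_j |N_{ji}|$ strictly smaller than $c_i$. *)
pose a (i : 'I_k) : RR := 1 + \sum_j `|ratr (N j i)|.
have a0 i : 0 < a i by rewrite ltr_pwDl // sumr_ge0.
have [eps eps0 epsP] := @positive_lower_bound RR k (fun i => c 0 i / a i)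
  (fun i => divr_gt0 (c0 i) (a0 i)).
have approx j : exists q : rat, `|t 0 j - ratr q| < eps.
  have [|q] := @rat_in_itvoo RR (t 0 j - eps) (t 0 j + eps); first by lra.
  rewrite in_itv /= => /andP[lo hi]; exists q.
  by rewrite ltr_norml; apply/andP; split; lra.
have [t' t'P] := choice approx.
exists (q0 + (\row_j t' j) *m N); last first.
  by rewrite mulmxDl q0A -mulmxA mulmx_ker mulmx0 addr0.
move=> i; rewrite -(ltr0q RR).
have -> : ratr ((q0 + (\row_j t' j) *m N) 0 i) =
    c 0 i - \sum_j (t 0 j - ratr (t' j)) * ratr (N j i).
  have := congr1 (fun w : 'rV_k => w 0 i) tE; rewrite !mxE => /eqP.
  rewrite subr_eq => /eqP ->; rewrite rmorphD /= rmorph_sum /=.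
  rewrite addrAC -sumrB addrC; congr (_ + _); rewrite rmorph_sum; apply: eq_bigr => j _.
  rewrite !mxE rmorphM /=; ring.
rewrite subr_gt0; apply: (@le_lt_trans _ _ (eps * \sum_j `|ratr (N j i)|)).
  rewrite mulr_sumr; apply: ler_sum => j _.
  by rewrite (le_trans (ler_norm _)) // normrM ler_wpM2r // ltW.
have := epsP i; rewrite ler_pdivlMr // /a mulrDr mulr1; lra.
Qed.

Lemma common_denominator k (q : 'I_k -> rat) : (forall i, 0 <= q i) ->
  exists2 d : nat, (0 < d)%N & exists n : 'I_k -> nat, forall i, q i * d%:R = (n i)%:R.
Proof.
move=> q0; exists (\prod_i `|denq (q i)|)%N.
  by apply: prodn_gt0 => i; rewrite absz_gt0 denq_neq0.
exists (fun i => `|numq (q i)| * \prod_(j | j != i) `|denq (q j)|)%N => i.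
rewrite (bigD1 i) //= !natrM mulrA; congr (_ * _).
by rewrite !pmulrn !abszE !ger0_norm ?denq_ge0 ?numq_ge0 // numqE.
Qed.

(** * Linearity of the support forms *)

Section FormValues.
Variables (A : pzRingType) (r s : nat) (sigma : 'M[int]_(r, s)) (i : 'I_s).
Implicit Types x y : 'rV[A]_r.

Lemma form_valD x y : form_val sigma i (x + y) = form_val sigma i x + form_val sigma i y.
Proof. by rewrite /form_val mulmxDl mxE. Qed.

Lemma form_valB x y : form_val sigma i (x - y) = form_val sigma i x - form_val sigma i y.
Proof. by rewrite /form_val mulmxBl !mxE. Qed.

Lemma form_valZ a x : form_val sigma i (a *: x) = a * form_val sigma i x.
Proof. by rewrite /form_val -scalemxAl mxE. Qed.

Lemma form_val0 : form_val sigma i (0 : 'rV[A]_r) = 0.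
Proof. by rewrite /form_val mul0mx mxE. Qed.

Lemma form_val_sum (T : Type) (w : seq T) (F : T -> 'rV[A]_r) :
  form_val sigma i (\sum_(c <- w) F c) = \sum_(c <- w) form_val sigma i (F c).
Proof. by rewrite /form_val mulmx_suml summxE. Qed.

Lemma form_val_intr (v : 'rV[int]_r) :
  form_val sigma i (map_mx intr v : 'rV[A]_r) = (form_val sigma i v)%:~R.
Proof.
rewrite /form_val -map_mxM mxE; congr (_%:~R); congr (fun_of_matrix (v *m _) _ _).
by apply/matrixP => j k; rewrite !mxE intz.
Qed.

End FormValues.

Lemma bezout_big_gcdn r (a : 'I_r -> int) :
  exists c : 'I_r -> int, \sum_k c k * a k = (\big[gcdn/0]_(k < r) `|a k|)%N.
Proof.
elim: r a => [|r IH] a; first by exists (fun=> 0); rewrite !big_ord0.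
have [c cE] := IH (fun k => a (lift ord0 k)).
have [u [v uvE]] := Bezoutz (a ord0) (\big[gcdn/0]_(k < r) `|a (lift ord0 k)|)%N.
exists (fun k => if unlift ord0 k is Some k' then v * c k' else u).
rewrite [in LHS]big_ord_recl unlift_none [in RHS]big_ord_recl.
under eq_bigr => k _ do rewrite liftK -mulrA.
by rewrite -mulr_sumr cE uvE.
Qed.

(** * Divisibility and facets in terms of the support forms *)

Section Semigroup.
Variables (RR : realType) (S : conomType) (r s : nat).
Variables (phi : S -> 'rV[int]_r) (sigma : 'M[int]_(r, s)).
Hypothesis S_positive : positive_semigroup S.
Hypothesis phi_gp : gp_identification phi.
Hypothesis S_normal : normal_semigroup phi.
Hypothesis sigma_support : support_forms RR phi sigma.

Implicit Types (x y z : S) (t q : 'I_s).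
Local Notation ht i x := (std_exponent phi sigma x i).
Local Notation mone := (@mone S).

Let phi_inj : injective phi. Proof. by case: phi_gp => -[]. Qed.
Let phi1 : phi mone = 0. Proof. by case: phi_gp => -[]. Qed.
Let phiM : {morph phi : x y / mmul x y >-> x + y}.
Proof. by case: phi_gp => -[]. Qed.

Lemma cone_gen x : cone phi (map_mx intr (phi x) : 'rV[RR]_r).
Proof.
exists [:: (1, x)]; rewrite big_seq1 scale1r; split=> // c.
by rewrite inE => /eqP ->; rewrite ler01.
Qed.

Lemma cone_formsP (y : 'rV[RR]_r) :
  cone phi y <-> forall i, 0 <= form_val sigma i y.
Proof. by case: sigma_support => _ -> _. Qed.

Lemma form_val_gen x i : form_val sigma i (phi x) = (ht i x)%:Z.
Proof.
rewrite /std_exponent mnmE gez0_abs // -(ler0z RR) -form_val_intr.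
exact: (cone_formsP _).1 (cone_gen x) i.
Qed.

Lemma std_exponentM x y i : ht i (mmul x y) = (ht i x + ht i y)%N.
Proof.
by apply/eqP; rewrite -eqz_nat PoszD -!form_val_gen phiM form_valD.
Qed.

Lemma std_exponent1 i : ht i mone = 0%N.
Proof. by rewrite /std_exponent mnmE phi1 form_val0. Qed.

Let power x n := iter n (mmul x) mone.

Lemma phi_power x n : phi (power x n) = phi x *+ n.
Proof.
elim: n => [|n IH]; first by rewrite phi1 mulr0n.
by rewrite [LHS]phiM IH -mulrS.
Qed.

Lemma phi_big k (x : 'I_k -> S) :
  phi (\big[@mmul S/mone]_(i < k) x i) = \sum_(i < k) phi (x i).
Proof. exact: (big_morph phi phiM phi1). Qed.

Lemma cone_integral (v : 'rV[int]_r) :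
  cone phi (map_mx intr v : 'rV[RR]_r) -> exists x, phi x = v.
Proof.
move=> [w [w0 vE]].
(* Zero weights are dropped because the passage to rational weights needs strictly positive ones. *)
pose w' := [seq c <- w | 0 < c.1].
pose k := size w'; pose c0 : RR * S := (0, mone).
pose x (i : 'I_k) := (nth c0 w' i).2.
pose A : 'M[rat]_(k, r) := \matrix_(i, j) (phi (x i) 0 j)%:~R.
have [q q0 qA] : exists2 q : 'rV[rat]_k,
    forall i, 0 < q 0 i & q *m A = map_mx intr v.
  apply: (@rational_positive_solution RR _ _ _ _ (\row_i (nth c0 w' i).1)).
    move=> i; rewrite mxE.
    by have := mem_nth c0 (ltn_ord i); rewrite mem_filter => /andP[].
  have -> : map_mx ratr (map_mx intr v : 'rV[rat]_r) = map_mx intr v :> 'rV[RR]_r.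
    by apply/rowP => j; rewrite !mxE ratr_int.
  rewrite vE (bigID (fun c : RR * S => 0 < c.1)) /= [X in _ = _ + X]big_seq_cond.
  rewrite [X in _ = _ + X]big1 => [|c /andP[/w0 c_ge0 c_le0]]; last first.
    suff -> : c.1 = 0 by rewrite scale0r.
    by apply/eqP; rewrite eq_le c_ge0 andbT leNgt.
  rewrite addr0 -big_filter -/w' (big_nth c0) big_mkord mulmx_sum_row.
  apply: eq_bigr => i _; rewrite mxE; congr (_ *: _).
  by apply/rowP => j; rewrite !mxE ratr_int.
have [d d0 [n nE]] := common_denominator (fun i => ltW (q0 i)).
(* Clearing the denominator $d$ puts $dv$ into $S$; normality then gives $v$. *)
apply: (S_normal d0); exists (\big[@mmul S/mone]_(i < k) power (x i) (n i)).
rewrite phi_big; apply/rowP => j; apply: (@intr_inj rat).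
have := congr1 (fun u : 'rV_r => u 0 j * d%:R) qA.
rewrite !mxE mulr_suml mulmxnE rmorphMn /= mulr_natr => <-.
rewrite summxE rmorph_sum; apply: eq_bigr => i _ /=.
by rewrite phi_power mulmxnE mxE mulrAC nE rmorphMn /= mulr_natl.
Qed.

Lemma lift_exponent (v : 'rV[int]_r) :
  (forall i, 0 <= form_val sigma i v) -> exists x, phi x = v.
Proof.
move=> v0; apply: cone_integral; apply/cone_formsP => i.
by rewrite form_val_intr ler0z.
Qed.

Lemma divides_exponent x y :
  (forall i, (ht i x <= ht i y)%N) -> exists z, y = mmul x z.
Proof.
move=> le_xy; have [i|z zE] := @lift_exponent (phi y - phi x).
  by rewrite form_valB !form_val_gen subr_ge0 lez_nat.
by exists z; apply: phi_inj; rewrite phiM zE addrC subrK.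
Qed.

(** Such an $x$ divides the neutral element, so it is invertible. *)
Lemma exponent_eq0 x : (forall i, ht i x = 0%N) -> x = mone.
Proof.
move=> x0; have [i|z zE] := @divides_exponent x mone; first by rewrite x0.
by apply: S_positive; exists z.
Qed.

Lemma form_val_cone (w : seq (RR * S)) t :
  form_val sigma t (\sum_(c <- w) c.1 *: map_mx intr (phi c.2)) =
  \sum_(c <- w) c.1 * (ht t c.2)%:R.
Proof.
rewrite form_val_sum; apply: eq_bigr => c _.
by rewrite form_valZ form_val_intr form_val_gen.
Qed.

(** A sum of nonnegative terms vanishes only termwise: a point of a facet is combined from elements
    of $S$ on that facet. *)
Lemma form_val_cone_eq0 (w : seq (RR * S)) t : (forall c, c \in w -> 0 <= c.1) ->
  form_val sigma t (\sum_(c <- w) c.1 *: map_mx intr (phi c.2)) = 0 ->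
  forall c, c \in w -> 0 < c.1 -> ht t c.2 = 0%N.
Proof.
move=> w0; rewrite form_val_cone big_seq => /eqP.
rewrite psumr_eq0 => [/allP w_eq0 c cw c0|c /w0 c0]; last by rewrite mulr_ge0.
have := w_eq0 c cw; rewrite cw /= mulf_eq0 gt_eqF //= pnatr_eq0.
by move/eqP.
Qed.

(** A nonzero real point of the intersection involves a nonzero element of $S$ with positive weight,
    and this element lies on the same facets. *)
Lemma facets_meet_nontrivial (I : {set 'I_s}) :
  facets_meet RR phi sigma I <> [set 0]%classic <->
  exists x, x <> mone /\ forall i, i \in I -> ht i x = 0%N.
Proof.
have meet0 : facets_meet RR phi sigma I 0.
  have cone0 : cone phi (0 : 'rV[RR]_r) by exists [::]; rewrite big_nil.
  by split=> // i _; split=> //; rewrite form_val0.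
split=> [nontrivial|[x [x1 xI]] trivial]; last first.
  apply: x1; apply: phi_inj; apply/rowP => j; apply: (@intr_inj RR).
  have : facets_meet RR phi sigma I (map_mx intr (phi x)).
    split=> [|i iI]; first exact: cone_gen.
    by split; [exact: cone_gen|rewrite form_val_intr form_val_gen xI].
  rewrite trivial => /= /(congr1 (fun u : 'rV_r => u 0 j)).
  by rewrite phi1 !mxE.
apply: contrapT => noX; apply: nontrivial.
rewrite predeqE => y; split=> [[[w [w0 ->]] yI]|-> //].
rewrite /= big_seq big1 // => c cw.
have := w0 c cw; rewrite le_eqVlt => /orP[/eqP <-|c0]; first by rewrite scale0r.
suff -> : c.2 = mone.
  rewrite phi1 (_ : map_mx intr 0 = 0) ?scaler0 //.
  by apply/rowP => j; rewrite !mxE.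
apply: contrapT => c1; apply: noX; exists c.2; split=> // i iI.
by have [_ /form_val_cone_eq0] := yI i iI; apply.
Qed.

Lemma exists_form_val_eq1 t : exists v : 'rV[int]_r, form_val sigma t v = 1.
Proof.
have [coprime _ _] := sigma_support.
have [c] := bezout_big_gcdn (fun k => sigma k t); rewrite coprime => cE.
exists (\row_k c k); rewrite /form_val mxE -[RHS]cE.
by apply: eq_bigr => k _; rewrite !mxE intz.
Qed.

(** A form with value $1$ on a difference of two elements of $S$ is positive on the first; one such
    element per form is taken, and they are added. *)
Lemma exists_interior : exists x, forall i, (0 < ht i x)%N.
Proof.
have pos i : exists x, (0 < ht i x)%N.
  have [v v1] := exists_form_val_eq1 i.
  have [_ /(_ v)[x [y vE]]] := phi_gp; exists x.
  by move: v1; rewrite vE form_valB !form_val_gen; lia.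
have [x xP] := choice pos.
exists (\big[@mmul S/mone]_i x i) => i.
by rewrite (bigD1 i) //= std_exponentM (leq_trans (xP i)) // leq_addr.
Qed.

(* By irredundancy some point violates only the t-th inequality; the segment
   from an interior point to it leaves the cone inside the facet F_t. *)
Lemma exists_facet_interior t :
  exists x, ht t x = 0%N /\ forall q, q != t -> (0 < ht q x)%N.
Proof.
have [_ coneE irredundant] := sigma_support.
have [y [ycond yt]] : exists y : 'rV[RR]_r,
    (forall i, i != t -> 0 <= form_val sigma i y) /\ form_val sigma t y < 0.
  apply: contrapT => noY; apply: (irredundant t); rewrite coneE predeqE => y.
  split=> [y0 i _|y0 i]; first exact: y0.
  have [->|] := eqVneq i t; last exact: y0.
  by rewrite leNgt; apply/negP => yt; apply: noY; exists y.
have [x xP] := exists_interior.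
pose X : 'rV[RR]_r := map_mx intr (phi x).
have X0 i : 0 < form_val sigma i X.
  by rewrite form_val_intr form_val_gen ltr0z ltz_nat.
pose p := form_val sigma t X *: y - form_val sigma t y *: X.
have pE i : form_val sigma i p = form_val sigma t X * form_val sigma i y -
    form_val sigma t y * form_val sigma i X by rewrite form_valB !form_valZ.
have pt : form_val sigma t p = 0 by rewrite pE mulrC subrr.
have pq q : q != t -> 0 < form_val sigma q p.
  move=> qt; rewrite pE -mulNr ltr_pwDr //.
    by rewrite mulr_gt0 // oppr_gt0.
  by rewrite mulr_ge0 ?ycond // ltW.
have [w [w0 wE]] : cone phi p.
  apply/cone_formsP => i; have [->|/pq/ltW//] := eqVneq i t.
  by rewrite pt.
(* Replacing the positive weights of $p$ by $1$ keeps the set of vanishing forms and gives an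
   element of $S$. *)
pose z := \big[@mmul S/mone]_(c <- w | 0 < c.1) c.2.
have zE q : ht q z = (\sum_(c <- w | (0 < c.1)%R) ht q c.2)%N.
  apply: (big_morph (fun x => ht q x)); last exact: std_exponent1.
  by move=> a b; apply: std_exponentM.
exists z; split.
  rewrite zE big_seq_cond big1 // => c /andP[cw c0].
  by apply: (form_val_cone_eq0 w0 _ cw c0); rewrite -wE.
move=> q /pq; rewrite wE form_val_cone lt0n zE; apply: contraTneq => /eqP.
rewrite sum_nat_seq_eq0 => /allP z0.
rewrite big_seq big1 ?ltxx // => c cw.
have := w0 c cw; rewrite le_eqVlt => /orP[/eqP <-|c0]; first by rewrite mul0r.
by have := z0 c cw; rewrite c0 /= => /eqP ->; rewrite mulr0.
Qed.

(** The element $z$ shows that $y$ is a zero divisor modulo $x$. *)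
Lemma common_facet_not_regular x y t : (0 < ht t x)%N -> (0 < ht t y)%N ->
  exists z, (exists u, mmul y z = mmul x u) /\ ~ exists u, z = mmul x u.
Proof.
move=> xt yt.
have [v v1] := exists_form_val_eq1 t.
have [w [wt wq]] := exists_facet_interior t.
(* As $w$ is positive at every $q \ne t$, adding $nw$ outweighs the subtraction of $v$ there and
   changes nothing at $t$. *)
pose n := (\sum_q `|form_val sigma q v|)%N.
pose u := phi x - v + phi (power w n).
have uE q : form_val sigma q u =
    (ht q x)%:Z - form_val sigma q v + (ht q w * n)%:Z.
  rewrite /u phi_power form_valD form_valB !form_val_gen; congr (_ + _).
  by rewrite -scaler_nat form_valZ form_val_gen mulrC natz.
have uq q : q != t -> (ht q x)%:Z <= form_val sigma q u.
  move=> /wq; have : (`|form_val sigma q v| <= n)%N by rewrite /n (bigD1 q) //= leq_addr.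
  rewrite uE; nia.
have ut : form_val sigma t u = (ht t x)%:Z - 1 by rewrite uE v1 wt mul0n addr0.
have [q|z zE] := @lift_exponent u.
  by have [->|/uq] := eqVneq q t; [rewrite ut|]; lia.
have zt : (ht t z)%:Z = (ht t x)%:Z - 1 by rewrite -form_val_gen zE.
exists z; split.
  apply: divides_exponent => q; rewrite std_exponentM.
  have [->|/uq] := eqVneq q t; first lia.
  by rewrite -zE form_val_gen; lia.
move=> [a zxa]; have := std_exponentM x a t; rewrite -zxa; lia.
Qed.

End Semigroup.

(** * Monomial ideals of the semigroup ring *)

Section MonomialIdeals.
Variables (K : fieldType) (S : conomType).
Implicit Types (x y z u : S) (xs : seq S) (f g : {malg K[S]}).
Local Notation mono x := (<< x >> : {malg K[S]}).

Definition in_multiples xs y := exists2 x, x \in xs & exists u, y = mmul x u.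

Lemma monoM x y : mono x * mono y = mono (mmul x y).
Proof. by rewrite malgM_def fgmulUU mulr1. Qed.

Lemma monoM_coef x y f : injective (mmul x) ->
  monalg.mcoeff (mmul x y) (mono x * f) = monalg.mcoeff y f.
Proof.
move=> inj; rewrite malgM_def fgmulUg raddf_sum /=.
under eq_bigr => z _ do rewrite mul1r mcoeffU (inj_eq inj).
have [yf|yf] := boolP (y \in monalg.msupp f); last first.
  rewrite (mcoeff_outdom yf) big_seq big1 // => z zf.
  by case: eqP zf yf => // -> ->.
rewrite (big_fsetD1 y) //= eqxx big_seq big1 ?addr0 // => z.
by rewrite !inE => /andP[/negbTE-> _].
Qed.

Lemma monomial_idealP xs f : seq_ideal [seq mono x | x <- xs] f <->
  forall y, y \in monalg.msupp f -> in_multiples xs y.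
Proof.
split.
  pose J := [set g : {malg K[S]} | forall y, y \in monalg.msupp g -> in_multiples xs y]%classic.
  apply: (@ideal_gen_min _ _ J).
    split=> [y|g h Jg Jh y|a g Jg y]; first by rewrite monalg.msupp0 inE.
      move=> /(fsubsetP (monalg.msuppD_le _ _)); rewrite inE => /orP[/Jg|/Jh] //.
    move=> /monalg.msuppM_le[k1 [k2 [_ /Jg[x xxs [u ->]] ->]]].
    by exists x => //; exists (mmul k1 u); rewrite mulmA (mulmC k1) -mulmA.
  move=> _ /mapP[x xxs ->] y; rewrite msuppU1 inE => /eqP->.
  by exists x => //; exists mone; rewrite mulm1.
move=> fxs; rewrite (monalgE f) big_seq; apply: ideal_sum.
  exact: ideal_gen_ideal.
move=> y /fxs[x xxs [u ->]].
have -> : << monalg.mcoeff (mmul x u) f *g mmul x u >> =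
    << monalg.mcoeff (mmul x u) f *g u >> * mono x.
  by rewrite malgM_def fgmulUU mulr1 mulmC.
apply: idealM; first exact: ideal_gen_ideal.
by apply: sub_ideal_gen => /=; apply: map_f.
Qed.

(** Multiplication by a monomial moves supports injectively, so regularity can be tested one
    monomial at a time. *)
Lemma monomial_regular_sequenceP xs : (forall x, injective (@mmul S x)) ->
  regular_sequence [seq mono x | x <- xs] <->
  ~ in_multiples xs mone /\
  forall i, (i < size xs)%N -> forall z,
    in_multiples (take i xs) (mmul (nth mone xs i) z) ->
    in_multiples (take i xs) z.
Proof.
move=> inj; have supp1 (x y : S) : y \in monalg.msupp (mono x) -> y = x.
  by rewrite msuppU1 inE => /eqP.
have properP : seq_ideal [seq mono x | x <- xs] 1 <-> in_multiples xs mone.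
  rewrite monomial_idealP; split=> [|H y /supp1 -> //].
  by apply; rewrite msuppU1 inE.
rewrite /regular_sequence properP size_map; split=> -[prop reg]; split=> //.
  move=> i ltis z xz.
  have /monomial_idealP : seq_ideal [seq mono x | x <- take i xs] (mono z).
    rewrite map_take; apply: reg => //; rewrite (nth_map mone) // monoM -map_take.
    by apply/monomial_idealP => y /supp1 ->.
  by apply; rewrite msuppU1 inE.
move=> i ltis a; rewrite -map_take (nth_map mone) //.
move=> /monomial_idealP Ja; apply/monomial_idealP => y ya; apply: reg => //.
by apply: Ja; rewrite -monalg.mcoeff_neq0 monoM_coef // monalg.mcoeff_neq0.
Qed.

End MonomialIdeals.

(** * Grade and monomial sequences *)

Section PositiveNormal.
Variables (K : fieldType) (RR : realType) (S : conomType) (r s : nat).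
Variables (phi : S -> 'rV[int]_r) (sigma : 'M[int]_(r, s)).
Hypothesis S_positive : positive_semigroup S.
Hypothesis phi_gp : gp_identification phi.
Hypothesis S_normal : normal_semigroup phi.
Hypothesis sigma_support : support_forms RR phi sigma.

Implicit Types (x y z : S) (t q : 'I_s) (xs : seq S).
Local Notation ht i x := (std_exponent phi sigma x i).
Local Notation mone := (@mone S).

Let htM x y t : ht t (mmul x y) = (ht t x + ht t y)%N.
Proof. exact: (std_exponentM phi_gp sigma_support). Qed.

Let ht_divides := divides_exponent phi_gp S_normal sigma_support.

Let ht_neq0 x : x <> mone -> exists t, (0 < ht t x)%N.
Proof.
move=> x1; apply: contrapT => noT; apply: x1.
apply: (exponent_eq0 S_positive phi_gp S_normal sigma_support) => t.
by apply/eqP; rewrite -leqn0 leqNgt; apply/negP => xt; apply: noT; exists t.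
Qed.

Let mmul_inj x : injective (mmul x).
Proof.
have [[phi_inj _ phiM] _] := phi_gp.
by move=> y z /(congr1 phi); rewrite !phiM => /addrI /phi_inj.
Qed.

Definition disjoint_supports xs :=
  forall i j, (j < i < size xs)%N -> forall t,
    (0 < ht t (nth mone xs i))%N -> ht t (nth mone xs j) = 0%N.

Lemma proper_multiples xs : ~ in_multiples xs mone <-> mone \notin xs.
Proof.
split=> [proper|/negP mone_xs [x xxs [u xu]]].
  apply/negP => mone_xs; apply: proper; exists mone => //; exists mone.
  by rewrite mulm1.
by apply: mone_xs; rewrite -(S_positive (ex_intro _ u (esym xu))).
Qed.

(** Where an earlier monomial $x$ has a positive exponent, the $i$-th one has exponent $0$; so if
    $x$ divides the product with $z$, it divides $z$. *)
Lemma regular_of_disjoint xs :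
  mone \notin xs -> disjoint_supports xs ->
  regular_sequence [seq (<< x >> : {malg K[S]}) | x <- xs].
Proof.
move=> xs1 disj; apply/(monomial_regular_sequenceP K _ mmul_inj).
split=> [|i ltis z]; first exact/proper_multiples.
move=> [x x_take [u xu]]; exists x => //.
have [j ltji xE] : exists2 j, (j < i)%N & x = nth mone xs j.
  exists (index x (take i xs)).
    by move: x_take; rewrite -index_mem size_take ltis.
  rewrite -(@nth_take i _ mone) ?nth_index //.
  by move: x_take; rewrite -index_mem size_take ltis.
apply: ht_divides => t; have [xt|xt] := posnP (ht t x); first by rewrite xt.
have := congr1 (fun y => ht t y) xu; rewrite !htM => xut.
have xi0 : ht t (nth mone xs i) = 0%N.
  apply/eqP; rewrite -leqn0 leqNgt; apply/negP => xit.
  by have := disj i j; rewrite ltji ltis -xE => /(_ isT t xit); lia.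
by move: xut; rewrite xi0; lia.
Qed.

(** A shared index gives a $z$ not divisible by the $j$-th monomial whose product with the $i$-th
    is. Regularity only puts $z$ into the ideal of all earlier monomials, so it must first be
    reduced to the $j$-th one. *)
Lemma disjoint_of_regular xs :
  regular_sequence [seq (<< x >> : {malg K[S]}) | x <- xs] ->
  mone \notin xs /\ disjoint_supports xs.
Proof.
move=> /(monomial_regular_sequenceP K _ mmul_inj)[/proper_multiples xs1 reg].
split=> // i; elim/ltn_ind: i => i IH j /andP[ltji ltis] t xit.
(* By induction on z, the i-th monomial is regular modulo the j-th one alone:
   a factor in another ideal generator can be cancelled since by the induction
   hypothesis its support is disjoint from that of the j-th monomial. *)
have cancel n z : (\sum_q ht q z < n)%N ->
    (exists u, mmul (nth mone xs i) z = mmul (nth mone xs j) u) ->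
    exists u, z = mmul (nth mone xs j) u.
  elim: n z => // n IHn z ltzn [u zu].
  have [|x x_take [z' zE]] := reg i ltis z.
    exists (nth mone xs j); last by exists u.
    by rewrite -(nth_take mone ltji) mem_nth // size_take ltis.
  have [l ltli xE] : exists2 l, (l < i)%N & x = nth mone xs l.
    have lti : (index x (take i xs) < i)%N.
      by move: x_take; rewrite -index_mem size_take ltis.
    exists (index x (take i xs)) => //.
    by rewrite -(nth_take mone lti) nth_index.
  have [lj|lj] := eqVneq l j; first by exists z'; rewrite zE xE lj.
  have x1 : x <> mone.
    by move=> x1; case/negP: xs1; rewrite -x1; apply: mem_take x_take.
  have [q0 xq0] := ht_neq0 x1.
  (* As $x$ is positive at [q0], the sum of the exponents drops from $z$ to $z'$. *)
  have [||u' z'u'] := IHn z'.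
    rewrite -ltnS (leq_ltn_trans _ ltzn) //= zE (bigD1 q0) //= [X in (_ < X)%N](bigD1 q0) //=.
    rewrite htM -addSn leq_add //; first by rewrite -add1n leq_add.
    by apply: leq_sum => q _; rewrite htM leq_addl.
    apply: ht_divides => q.
    have := congr1 (fun y => ht q y) zu; rewrite zE !htM => zuq.
    have [xq|xq] := posnP (ht q x); first by lia.
    have xj0 : ht q (nth mone xs j) = 0%N.
      have [ltlj|] := ltnP l j.
        apply/eqP; rewrite -leqn0 leqNgt; apply/negP => xjq.
        have := IH j ltji l; rewrite ltlj (ltn_trans ltji ltis) -xE.
        by move=> /(_ isT q xjq); lia.
      rewrite leq_eqVlt eq_sym (negbTE lj) /= => ltjl.
      by apply: (IH l ltli); rewrite -?xE // ltjl (ltn_trans ltli ltis).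
    by rewrite xj0.
  by exists (mmul x u'); rewrite zE z'u' mulmA (mulmC x) -mulmA.
apply/eqP; rewrite -leqn0 leqNgt; apply/negP => xjt.
have [z [zu nz]] :=
  common_facet_not_regular phi_gp S_normal sigma_support xjt xit.
by apply: nz; apply: (cancel _ z (ltnSn _)).
Qed.

Let facets_meetP := facets_meet_nontrivial phi_gp sigma_support.

Lemma facets_meet_trivialP (I : {set 'I_s}) :
  facets_meet RR phi sigma I = [set 0]%classic <->
  forall x, x <> mone -> exists2 t, t \in I & (0 < ht t x)%N.
Proof.
split=> [trivial x x1|transversal].
  apply: contrapT => noT; apply: (facets_meetP I).2 trivial.
  exists x; split=> // t tI; apply/eqP; rewrite -leqn0 leqNgt; apply/negP => xt.
  by apply: noT; exists t.
apply: contrapT => /facets_meetP[x [x1 xI]].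
by have [t /xI ->] := transversal x x1.
Qed.

(** The sets are the supports of the monomials; conversely, a nonzero element on all facets outside
    $G_i$ has its support inside $G_i$. *)
Lemma monomial_sequence_length_iff k :
  (exists xs : seq S,
     regular_sequence [seq (<< x >> : {malg K[S]}) | x <- xs] /\ size xs = k) <->
  (exists G : 'I_k -> {set 'I_s},
     (forall i j, i != j -> G i :&: G j = finset.set0) /\
     (forall i, facets_meet RR phi sigma (~: G i) <> [set 0]%classic)).
Proof.
split=> [[xs [/disjoint_of_regular[xs1 disj] sizexs]]|[G [disjG meetG]]].
  exists (fun i => [set t | 0 < ht t (nth mone xs i)]%N)%SET; split=> [i j ij|i].
    apply/setP => t; rewrite !inE; apply/negbTE/negP => /andP[xit xjt].
    have [ltji|ltij|eqij] := ltngtP j i.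
    - by have := disj i j; rewrite ltji sizexs ltn_ord => /(_ isT t xit); lia.
    - by have := disj j i; rewrite ltij sizexs ltn_ord => /(_ isT t xjt); lia.
    - by case/eqP: ij; apply: val_inj.
  apply/facets_meetP; exists (nth mone xs i); split=> [xi1|t].
    by case/negP: xs1; rewrite -xi1 mem_nth // sizexs.
  by rewrite !inE -leqNgt leqn0 => /eqP.
have [x xP] := choice (fun i => (facets_meetP _).1 (meetG i)).
exists [seq x i | i <- enum 'I_k]; split; last by rewrite size_map size_enum_ord.
apply: regular_of_disjoint.
  by apply/negP => /mapP[i _ /esym xi1]; have [] := xP i.
move=> i j; rewrite size_map size_enum_ord => /andP[ltji ltik] t.
have nthE l (ltlk : (l < k)%N) :
    nth mone [seq x i | i <- enum 'I_k] l = x (Ordinal ltlk).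
  rewrite (nth_map (Ordinal ltlk)) ?size_enum_ord //; congr x.
  by apply: val_inj; rewrite /= nth_enum_ord.
rewrite (nthE i ltik) (nthE j (ltn_trans ltji ltik)).
have [_ xi] := xP (Ordinal ltik).
have [_ xj] := xP (Ordinal (ltn_trans ltji ltik)) => xit.
apply: xj; rewrite inE; apply/negP => tj.
have ti : t \in G (Ordinal ltik).
  by apply/negPn/negP => ti; move: xit; rewrite xi // inE.
have : t \in G (Ordinal ltik) :&: G (Ordinal (ltn_trans ltji ltik)).
  by rewrite inE ti.
rewrite disjG ?inE //; apply/eqP => /(congr1 val) /= ij.
by have := ltji; rewrite ij ltnn.
Qed.

(** Each $G_i$ is nonempty, since all facets together meet only in $0$; picking an index from each
    is injective. *)
Lemma disjoint_facet_sets_bound k (G : 'I_k -> {set 'I_s}) :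
  (forall i j, i != j -> G i :&: G j = finset.set0) ->
  (forall i, facets_meet RR phi sigma (~: G i) <> [set 0]%classic) ->
  (k <= s)%N.
Proof.
move=> disjG meetG.
have nonempty i : exists t, t \in G i.
  have [x [x1 xG]] := (facets_meetP _).1 (meetG i).
  have [t xt] := ht_neq0 x1; exists t.
  by apply/negPn/negP => tG; move: xt; rewrite xG // inE.
have [t tG] := choice nonempty.
rewrite -(card_ord k) -[X in (_ <= X)%N](card_ord s); apply: (@leq_card _ _ t) => i j tij.
apply/eqP; apply/negPn/negP => /disjG /setP /(_ (t i)).
by rewrite !inE tG tij tG.
Qed.

(** No sum of nonzero elements of $S$ is $0$, so the constant coefficient is a ring morphism, and
    its kernel is an ideal. *)
Lemma monomial_max_ideal_coef1 (f : {malg K[S]}) :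
  monomial_max_ideal f -> monalg.mcoeff mone f = 0.
Proof.
apply: (@ideal_gen_min _ _ [set g : {malg K[S]} | monalg.mcoeff mone g = 0]%classic).
  split=> [|g h /= g0 h0|a g /= g0]; first exact: monalg.mcoeff0.
    by rewrite monalg.mcoeffD g0 h0 addr0.
  by rewrite rmorphM /= g0 mulr0.
move=> _ [x [-> xu]] /=; rewrite mcoeffU1; case: eqP => // x1.
by case: xu; exists 1; rewrite mulr1 x1.
Qed.

Lemma monomial_max_ideal_gen x : x <> mone ->
  monomial_max_ideal (<< x >> : {malg K[S]}).
Proof.
move=> x1; apply: sub_ideal_gen => /=; exists x; split=> // -[b xb].
have := congr1 (monalg.mcoeff mone) xb; rewrite rmorphM rmorph1 /= mcoeffU1.
by case: eqP => // _ /eqP; rewrite mul0r eq_sym oner_eq0.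
Qed.

Lemma extended_max_ideal_gen x : x <> mone ->
  extended_max_ideal phi sigma ('X_[std_exponent phi sigma x] : mpoly s K).
Proof.
move=> x1; apply: sub_ideal_gen => /=; exists << x >>; split.
  exact: monomial_max_ideal_gen.
by rewrite /std_embedding mmapU [X in X * _](mpolyC1 s K) mul1r.
Qed.

Lemma extended_max_ideal_sub (I : {set 'I_s}) (f : mpoly s K) :
  facets_meet RR phi sigma I = [set 0]%classic ->
  extended_max_ideal phi sigma f -> pow_ideal 1 I f.
Proof.
move=> /facets_meet_trivialP transversal.
apply: ideal_gen_min; first exact: pow_ideal_ideal.
move=> _ [g [/monomial_max_ideal_coef1 g1 ->]]; rewrite /std_embedding /monalg.mmap.
rewrite big_seq; apply: (ideal_sum _ (pow_ideal_ideal K 1 I)) => x xg.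
apply: (idealM _ (pow_ideal_ideal K 1 I)).
have [|t tI xt] := transversal x; last exact: (pow_idealX K tI).
by move=> x1; move: xg; rewrite -monalg.mcoeff_neq0 x1 g1 eqxx.
Qed.

Lemma grade_extended_max_ideal u :
  is_minimum (fun k => exists I : {set 'I_s},
    #|I| = k /\ facets_meet RR phi sigma I = [set 0]%classic) u ->
  is_grade (@extended_max_ideal K S r s phi sigma) u.
Proof.
move=> [[I [cardI meetI]] minu]; split; last first.
  move=> k [xs [reg mPxs <-]]; rewrite -cardI; apply: regular_in_variables_size reg _.
  by move=> f /mPxs; apply: extended_max_ideal_sub.
have le_us : (u <= s)%N by rewrite -cardI -[X in (_ <= X)%N](card_ord s) max_card.
(* The complement of a large $T$ has fewer than $u$ elements, so by minimality it misses the support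
   of some $x \ne 0$. The size condition sits under the quantifier so that [choice] gives a total
   function. *)
have generator (T : {set 'I_s}) : exists x, (s - u < #|T|)%N ->
    x <> mone /\ forall t, t \notin T -> ht t x = 0%N.
  have [large|small] := ltnP (s - u) #|T|; last by exists mone.
  apply: contrapT => noX.
  have /minu : exists J : {set 'I_s}, #|J| = #|~: T| /\
      facets_meet RR phi sigma J = [set 0]%classic.
    exists (~: T); split=> //; apply/facets_meet_trivialP => x x1.
    apply: contrapT => noT; apply: noX; exists x => _; split=> // t tT.
    apply/eqP; rewrite -leqn0 leqNgt; apply/negP => xt.
    by apply: noT; exists t; rewrite // inE.
  by have := cardsC T; rewrite card_ord; lia.
have [x xP] := choice generator.
(* $N$ bounds all exponents of the chosen elements; the successor keeps it positive, as properness
   requires. *)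
pose N := (\sum_T \sum_t ht t (x T)).+1.
have le_N T t : (ht t (x T) <= N)%N.
  by rewrite leqW // (bigD1 T) //= (bigD1 t) //= -addnA leq_addr.
exists (take u (elem_syms K s N s)); split.
- exact: elem_syms_regular_sequence.
- move=> f /elem_syms_mem[j [_ ltj ->]]; apply: ideal_sum.
    exact: ideal_gen_ideal.
  move=> T /eqP cardT; have [|x1 xT] := xP T; first by rewrite cardT.
  (* Hence the term of $T$ is a multiple of a monomial of $\mathfrak{m}P$. *)
  have le_box : (std_exponent phi sigma (x T) <= box N T)%MM.
    apply/mnm_lepP => t; rewrite [box _ _ _]mnmE.
    by have [tT|/xT->] := boolP (t \in T); rewrite ?muln1.
  rewrite -(submK le_box) mpolyXD; apply: idealM; first exact: ideal_gen_ideal.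
  exact: extended_max_ideal_gen.
- by rewrite size_takel // size_elem_syms.
Qed.

Lemma exists_minimum_facets :
  exists u, is_minimum (fun k => exists I : {set 'I_s},
    #|I| = k /\ facets_meet RR phi sigma I = [set 0]%classic) u.
Proof.
apply: (@inhabited_has_minimum _ #|finset.setT : {set 'I_s}|).
exists finset.setT; split=> //; apply/facets_meet_trivialP => x /ht_neq0[t xt].
by exists t; rewrite ?inE.
Qed.

End PositiveNormal.

Theorem proposition4p2 (K : fieldType) (RR : realType) (S : conomType)
    (r s : nat) (phi : S -> 'rV[int]_r) (sigma : 'M[int]_(r, s))
    (S_affine : affine_semigroup S)
    (S_positive : positive_semigroup S)
    (phi_gp : gp_identification phi)
    (S_normal : normal_semigroup phi)
    (sigma_support : support_forms RR phi sigma) :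
  (exists u : nat,
     is_grade (@extended_max_ideal K S r s phi sigma) u /\
     is_minimum (fun k => exists I : {set 'I_s},
       #|I| = k /\ facets_meet RR phi sigma I = [set 0]%classic) u)
  /\
  (exists l : nat,
     max_monomial_sequence_length K S l /\
     is_maximum (fun k => exists G : 'I_k -> {set 'I_s},
       (forall i j, i != j -> G i :&: G j = finset.set0) /\
       (forall i, facets_meet RR phi sigma (~: G i) <> [set 0]%classic)) l).
Proof.
split.
  have [u minu] := exists_minimum_facets S_positive phi_gp S_normal sigma_support.
  by exists u; split=> //; apply: grade_extended_max_ideal minu.
have iffQ :=
  monomial_sequence_length_iff K S_positive phi_gp S_normal sigma_support.
pose Q k := exists G : 'I_k -> {set 'I_s},
  (forall i j, i != j -> G i :&: G j = finset.set0) /\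
  (forall i, facets_meet RR phi sigma (~: G i) <> [set 0]%classic).
have [||l [Ql maxl]] := @bounded_has_maximum Q s.
(* The empty family satisfies the conditions for $k = 0$. *)
- by exists (fun=> finset.set0); split=> -[].
- move=> k [G [disjG meetG]].
  exact: (disjoint_facet_sets_bound S_positive phi_gp S_normal sigma_support disjG meetG).
exists l; split=> //; split; first exact/iffQ.
by move=> k /iffQ /maxl.
Qed.
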